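(* Let $S$ be a finite semigroup with zero $0$. Then its radical $R(S)$ is a nilpotent semigroup.
   Context: $S^1$ is $S$ with an identity adjoined if $S$ has none; $(x)=S^1xS^1$. A subsemigroup $T$ of $S$ is nilpotent if $T^m=\{0\}$ for some $m\in\mathbb{N}$. The radical is $R(S)=\{x\in S:(x)\text{ is a nilpotent semigroup}\}$. *)

(* Defs.v *)
From HB Require Import structures.
From mathcomp Require Import all_boot all_classical.

Set Implicit Arguments.
Unset Strict Implicit.
Unset Printing Implicit Defensive.

Import Algebra.
Local Open Scope classical_set_scope.
Local Open Scope group_scope.

Definition is_zero (S : semigroupType) (z : S) : Prop :=
  left_zero z *%g /\ right_zero z *%g.

Definition has_identity (S : semigroupType) : Prop :=
  exists e : S, left_id e *%g /\ right_id e *%g.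

(* S with a fresh identity None, unconditionally; the monoid S^1 is the subset S1
   of it, which contains None only if S has no identity. *)
Definition adjoin1 (S : semigroupType) : Type := option S.

HB.instance Definition _ (S : semigroupType) := Choice.on (adjoin1 S).

Definition adjoin1_mul (S : semigroupType) (a b : adjoin1 S) : adjoin1 S :=
  match a, b with
  | None, _ => b
  | _, None => a
  | Some x, Some y => Some (x * y)
  end.

Lemma adjoin1_mulA (S : semigroupType) : associative (@adjoin1_mul S).
Proof. by case=> [x|] [y|] [t|] //=; rewrite mulgA. Qed.

HB.instance Definition _ (S : semigroupType) :=
  isSemigroup.Build (adjoin1 S) (@adjoin1_mulA S).

Definition adjoin1_inj (S : semigroupType) (x : S) : adjoin1 S := Some x.

Definition S1 (S : semigroupType) : set (adjoin1 S) :=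
  range (@adjoin1_inj S) `|` [set a | a = None /\ ~ has_identity S].
Arguments S1 : clear implicits.

Definition principal_ideal (S : semigroupType) (x : S) : set S :=
  @adjoin1_inj S @^-1`
    [set a * adjoin1_inj x * b | a in S1 S & b in S1 S].

Definition set_mul (S : semigroupType) (A B : set S) : set S :=
  [set a * b | a in A & b in B].

(* T^m for m >= 1; the value at m = 0 is junk. *)
Definition set_pow (S : semigroupType) (T : set S) (m : nat) : set S :=
  iter m.-1 (set_mul T) T.

(* Nonemptiness of T need not be required: it follows from T^m = {z}. *)
Definition nilpotent_semigroup (S : semigroupType) (z : S) (T : set S) : Prop :=
  set_mul T T `<=` T /\ exists2 m, (0 < m)%N & set_pow T m = [set z].

Definition radical (S : semigroupType) (z : S) : set S :=
  [set x | nilpotent_semigroup z (principal_ideal x)].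

(* Main.v *)
(** In a product of sufficiently many radical elements some [x] occurs more often
    than the nilpotency index of [(x)], by the pigeonhole principle. Cutting the
    product after each occurrence of [x] exhibits it as an element of a high power
    of the ideal [(x)], so it is zero. *)
Require Import Defs.
From mathcomp Require Import all_boot all_classical.

Local Open Scope classical_set_scope.

Section PrincipalIdeal.
Local Set Implicit Arguments.
Variable S : semigroupType.
Implicit Types (x y u : S) (T : set S).
Local Open Scope group_scope.

Lemma S1_inj x : S1 S (adjoin1_inj x).
Proof. by left; exists x. Qed.

(** A factor from $S$ keeps the product in $S$, even if [a] is the adjoined identity. *)
Lemma S1_mul_injl x (a : adjoin1 S) : S1 S (adjoin1_inj x * a).
Proof. by case: a => [y|]; apply: S1_inj. Qed.

Lemma principal_ideal_self x : principal_ideal x x.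
Proof.
have [[e [e1 e2]]|nid] := pselect (has_identity S).
(* Here [None] is not in [S1], so $x$ is written as $exe$. *)
- exists (adjoin1_inj e); first exact: S1_inj.
  exists (adjoin1_inj e); first exact: S1_inj.
  by rewrite -[RHS]/(Some x) -[in RHS](e1 x) -[in RHS](e2 (e * x)).
- have S1N : S1 S None by right.
  by exists None => //; exists None.
Qed.

Lemma principal_ideal_mull x u y :
  principal_ideal x y -> principal_ideal x (u * y).
Proof.
move=> [a _ [b Sb aby]]; exists (adjoin1_inj u * a); first exact: S1_mul_injl.
by exists b => //; rewrite -2!mulgA [X in _ * X]mulgA aby.
Qed.

(** In $a(xy)b = ax(yb)$ the right multiplier absorbs $y$. *)
Lemma principal_ideal_mulr x y : principal_ideal (x * y) `<=` principal_ideal x.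
Proof.
move=> u [a Sa [b _ abu]]; exists a => //.
exists (adjoin1_inj y * b); first exact: S1_mul_injl.
rewrite -abu -[adjoin1_inj (x * y)]/(adjoin1_inj x * adjoin1_inj y).
by rewrite !mulgA.
Qed.

Lemma principal_ideal_subsemigroup x :
  set_mul (principal_ideal x) (principal_ideal x) `<=` principal_ideal x.
Proof. by move=> _ [u _ [v xv <-]]; apply: principal_ideal_mull. Qed.

End PrincipalIdeal.

Section SetPow.
Local Set Implicit Arguments.
Variable S : semigroupType.
Implicit Types (x y u : S) (T : set S).
Local Open Scope group_scope.

Lemma set_powS T n : set_pow T n.+2 = set_mul T (set_pow T n.+1).
Proof. by []. Qed.

Lemma set_pow_sub T U n : T `<=` U -> set_pow T n.+1 `<=` set_pow U n.+1.
Proof.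
move=> TU; elim: n => [|n IH] //; rewrite !set_powS; move=> _ [u Tu [v Tv <-]].
by exists u; [exact: TU | exists v => //; exact: IH].
Qed.

(** The first factor of $y$ absorbs $u$, so a letter can be put in front of a word without lowering
    the exponent. *)
Lemma set_pow_mull T n u y : (forall v, T v -> T (u * v)) ->
  set_pow T n.+1 y -> set_pow T n.+1 (u * y).
Proof.
case: n => [|n] Tu; first exact: Tu.
rewrite !set_powS => -[v Tv [w Tw <-]].
by exists (u * v); [exact: Tu | exists w => //; rewrite mulgA].
Qed.

Lemma set_pow_idem T n u : u * u = u -> T u -> set_pow T n.+1 u.
Proof.
move=> uu Tu; elim: n => [|n IH] //; rewrite set_powS.
by exists u => //; exists u.
Qed.

(* [w] lists the factors of some factorization of [y] over [T]. *)
Lemma set_pow_word T n y : set_pow T n.+1 y ->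
  exists w : seq S, [/\ size w = n.+1, forall x, x \in w -> T x
    & forall x k, (k < count_mem x w)%N -> set_pow (principal_ideal x) k.+1 y].
Proof.
elim: n y => [|n IH] y.
- move=> Ty; exists [:: y]; split => // [x|x k /=].
    by rewrite inE => /eqP ->.
  by case: eqP => [<-|] //; case: k => // _; exact: principal_ideal_self.
- rewrite set_powS => -[t Tt [u /IH[w [szw wT wpow]] <-]].
  exists (t :: w); split => [|x|x k /=]; first by rewrite /= szw.
    by rewrite inE => /predU1P[->|/wT].
  case: eqP => [<-|_] /=.
    (* The new letter is $x = t$. For positive exponent in the tail, $t \in (t)$ supplies one more
       factor. For [k = 0] nothing is known about $u$, and $tu \in (t)$ follows by absorbing $u$
       into the right multiplier of $t = atb$. *)
    case: k => [_|k]; last first.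
      rewrite add1n ltnS => /wpow uk; exists t; last by exists u.
      exact: principal_ideal_self.
    have [a Sa [b _ abt]] := @principal_ideal_self S t.
    exists a => //; exists (b * adjoin1_inj u); last by rewrite mulgA abt.
    by case: b {abt} => [v|]; apply: S1_inj.
  (* A letter $t \ne x$ is absorbed by the left ideal $(x)$. *)
  by move=> /wpow; apply: set_pow_mull => v; apply: principal_ideal_mull.
Qed.

End SetPow.

(** Each letter [x] has its own capacity [m x]. The size of [w] is the sum of its multiplicities
    over the distinct letters of [s], so it could not exceed the total capacity if no letter
    exceeded its own. *)
Lemma seq_pigeonhole (T : eqType) (s w : seq T) (m : T -> nat) :
  {subset w <= s} -> (\sum_(x <- undup s) m x < size w)%N ->
  exists x, (m x < count_mem x w)%N.
Proof.
move=> ws; apply: contraPP => /forallNP mw; apply/negP; rewrite -leqNgt.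
have -> : size w = (\sum_(x <- undup s) count_mem x w)%N.
  elim: w ws {mw} => [|t w IH] ws /=; first by rewrite big1.
  rewrite big_split /= -IH; last by move=> x xw; apply: ws; rewrite inE xw orbT.
  rewrite (bigD1_seq t) ?undup_uniq ?mem_undup ?ws ?mem_head //= eqxx.
  by rewrite big1 // => x /negPf; rewrite eq_sym => ->.
by apply: leq_sum => x _; rewrite leqNgt; apply/negP/mw.
Qed.

Section Radical.
Local Set Implicit Arguments.
Variables (S : semigroupType) (z : S).
Hypothesis zero_z : is_zero z.
Local Open Scope group_scope.

Lemma principal_ideal_zero_mem (x : S) : principal_ideal x z.
Proof.
rewrite -(zero_z.1 x); apply: principal_ideal_mull.
exact: principal_ideal_self.
Qed.

(** $T^m \subseteq U^m = \{z\}$, and conversely $z = z^m \in T^m$. *)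
Lemma nilpotent_semigroup_sub (T U : set S) : T `<=` U ->
  set_mul T T `<=` T -> T z -> nilpotent_semigroup z U ->
  nilpotent_semigroup z T.
Proof.
move=> TU TT Tz [_ [[|m] // m0 Um]]; split => //; exists m.+1 => //.
rewrite eqEsubset; split; first by rewrite -Um; apply: set_pow_sub.
by move=> _ ->; apply: set_pow_idem => //; apply: zero_z.1.
Qed.

Lemma radical_mulr (x y : S) : radical z x -> radical z (x * y).
Proof.
apply: nilpotent_semigroup_sub; first exact: principal_ideal_mulr.
- exact: principal_ideal_subsemigroup.
- exact: principal_ideal_zero_mem.
Qed.

(** The ideal $(z)$ is $\{z\}$, so exponent 1 works. *)
Lemma radical_zero : radical z z.
Proof.
split; first exact: principal_ideal_subsemigroup.
exists 1%N => //; rewrite eqEsubset; split; last first.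
  by move=> _ ->; apply: principal_ideal_self.
move=> u [a _ [b _]].
have -> : a * adjoin1_inj z = Some z.
  by case: a => // v; rewrite -[LHS]/(Some (v * z)) zero_z.2.
case: b => [v|] [<-] //; exact: zero_z.1.
Qed.

End Radical.

Theorem corollary3p4 (S : semigroupType) (finS : finite_set [set: S])
    (z : S) (zero_z : is_zero z) :
  nilpotent_semigroup z (radical z).
Proof.
split; first by move=> _ [x Rx [y _ <-]]; apply: radical_mulr.
have /finite_seqP[s sT] := finS.
(* [m x] is one less than a nilpotency exponent of $(x)$, so more than [m x] occurrences of $x$
   suffice. Outside the radical the value 0 is a mere default. *)
have /choice[m mP] : forall x : S, exists m, radical z x ->
    set_pow (principal_ideal x) m.+1 `<=` [set z].
  move=> x; have [[_ [[|m] // _ xm]]|nRx] := pselect (radical z x).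
    by exists m => _; rewrite xm.
  by exists 0%N.
(* One more than the total capacity of all elements of $S$. *)
exists (\sum_(x <- undup s) m x).+1 => //.
rewrite eqEsubset; split; last first.
  move=> _ ->; apply: set_pow_idem; first exact: zero_z.1.
  exact: radical_zero.
move=> y /set_pow_word[w [szw wR wpow]].
have ws : {subset w <= s}.
  by move=> x _; have : [set: S] x by []; rewrite sT.
have [x mx] : exists x, (m x < count_mem x w)%N.
  by apply: seq_pigeonhole ws _; rewrite szw.
apply: (mP x); last exact: wpow.
(* The count of [x] is positive, so [x] is a letter of [w] and hence lies in the radical. *)
by apply: wR; rewrite -has_pred1 has_count (leq_ltn_trans _ mx).
Qed.
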